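(* Let $n\ge 1$ be an integer, and let $A$ and $B$ be the $n\times n$ symmetric matrices whose entries are the commuting variables $a_{\{i,j\}}$ and $b_{\{i,j\}}$, that is, $A_{ij}=A_{ji}=a_{\{i,j\}}$ and $B_{ij}=B_{ji}=b_{\{i,j\}}$ for $1\le i\le j\le n$. Let $p$ be the coefficient of $t^2$ in $\operatorname{trace}((A+tB)^6)$, a polynomial with real coefficients in the variables $a_{\{i,j\}}, b_{\{i,j\}}$. Then $p$ is a sum of squares of polynomials in the variables $a_{\{i,j\}}$ and $b_{\{i,j\}}$: there exist real positive semidefinite matrices $U$ and $R$, a vector $y$, and vectors $z_{(i,j)}$ for $1\le i<j\le n$ (with the same matrix $R$ used for all pairs $(i,j)$), the entries of $y$ and of the $z_{(i,j)}$ being polynomials in the variables $a_{\{i,j\}}, b_{\{i,j\}}$, such that $$p \;=\; y^{T}Uy+\sum_{1\le i<j\le n} z_{(i,j)}^{T}\,R\,z_{(i,j)}.$$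
   Context: The variables $a_{\{i,j\}}$ and $b_{\{i,j\}}$, for $1\le i\le j\le n$ (with $\{i,i\}$ denoting the diagonal index), are $2n+2\binom n2$ independent commuting real variables; $t$ is a further commuting variable. The polynomial $p$ lives in the ring $\mathbb{R}[a_{\{i,j\}},b_{\{i,j\}}]$. ''Positive semidefinite matrix'' means a real symmetric positive semidefinite matrix with constant (real number) entries; $y$ has length equal to the size of $U$, and each $z_{(i,j)}$ has length equal to the size of $R$. *)

(* Defs.v *)
From HB Require Import structures.
From mathcomp Require Import all_boot all_order all_algebra.
From mathcomp Require Import reals.
From mathcomp Require Import mpoly.
Set Implicit Arguments.
Unset Strict Implicit.
Unset Printing Implicit Defensive.

Import Order.TTheory GRing.Theory Num.Theory.
Local Open Scope ring_scope.

(* The index {i,j} is literally the set [set i; j], so the matrices A and B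
   are symmetric by construction; the diagonal index {i,i} is [set i]. *)
Definition upair (n : nat) := {S : {set 'I_n} | (0 < #|S| <= 2)%N}.

Lemma upair_subproof (n : nat) (i j : 'I_n) : (0 < #|[set i; j]| <= 2)%N.
Proof. by rewrite cards2; case: (i != j). Qed.

Definition mk_upair (n : nat) (i j : 'I_n) : upair n :=
  exist _ [set i; j] (upair_subproof i j).

Lemma mk_upairC (n : nat) (i j : 'I_n) : mk_upair i j = mk_upair j i.
Proof. by apply: val_inj; rewrite /= setUC. Qed.

Lemma card_upair (n : nat) : #|{: upair n}| = (n + 'C(n, 2))%N.
Proof.
rewrite card_sub -sum1_card.
rewrite (bigID (fun S : {set 'I_n} => #|S| == 1)%N) /=.
rewrite !sum1_card; congr (_ + _)%N.
  rewrite -[RHS](bin1 n) -[n in RHS]card_ord -card_draws.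
  apply: eq_card => S; rewrite !inE unfold_in /= inE.
  by case: #|S| => [|[|[|k]]].
rewrite -[n in RHS]card_ord -card_draws.
apply: eq_card => S; rewrite !inE unfold_in /= inE.
by case: #|S| => [|[|[|k]]].
Qed.

(* [inl e] indexes the variable a_e and [inr e] the variable b_e. *)
Definition var (n : nat) := (upair n + upair n)%type.

Definition nvars (n : nat) : nat := #|{: var n}|.

Lemma nvarsE (n : nat) : nvars n = (2 * n + 2 * 'C(n, 2))%N.
Proof. by rewrite /nvars card_sum card_upair -mulnDr mul2n addnn. Qed.

Definition avar (R : realType) (n : nat) (e : upair n) : {mpoly R[nvars n]} :=
  'X_(enum_rank (inl e : var n)).

Definition bvar (R : realType) (n : nat) (e : upair n) : {mpoly R[nvars n]} :=
  'X_(enum_rank (inr e : var n)).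

Definition Amx (R : realType) (n : nat) : 'M[{mpoly R[nvars n]}]_n :=
  \matrix_(i, j) avar R (mk_upair i j).

Definition Bmx (R : realType) (n : nat) : 'M[{mpoly R[nvars n]}]_n :=
  \matrix_(i, j) bvar R (mk_upair i j).

(* The variable t is the indeterminate 'X of {poly {mpoly R[nvars n]}}. *)
Definition trace_coef (R : realType) (n : nat) : {mpoly R[nvars n]} :=
  (\tr ((map_mx polyC (Amx R n) + 'X *: map_mx polyC (Bmx R n)) ^+ 6))`_2.

Definition psdmx (R : realType) (m : nat) (U : 'M[R]_m) : Prop :=
  U^T = U /\ forall x : 'cV[R]_m, 0 <= (x^T *m U *m x) 0 0.

Definition is_sos (R : realType) (k : nat) (p : {mpoly R[k]}) : Prop :=
  exists (m : nat) (q : 'I_m -> {mpoly R[k]}), p = \sum_(i < m) q i ^+ 2.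

Definition qform (R : realType) (k m : nat) (U : 'M[R]_m)
    (y : 'cV[{mpoly R[k]}]_m) : {mpoly R[k]} :=
  (y^T *m map_mx (@mpolyC k R) U *m y) 0 0.

(* Main.v *)
Require Import Defs.
From mathcomp Require Import all_boot all_order all_algebra.
From mathcomp Require Import reals.
From mathcomp Require Import ring zify.
From mathcomp Require Import mpoly.
Set Implicit Arguments.
Unset Strict Implicit.
Unset Printing Implicit Defensive.

Import Order.TTheory GRing.Theory Num.Theory.
Local Open Scope ring_scope.

(** Fifteen words in [A] and [B] contribute to the coefficient of [t^2]: those
    with two letters [B]. Up to cyclic rotation, which the trace does not see,
    there are three of them, and
      [p = 6 tr(A^4 B^2) + 6 tr(A^3 B A B) + 3 tr(A^2 B A^2 B)]
    ([trace_pencil6_coef2]). For symmetric [A] and [B], put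
    [X = 2 A^2 B + A B A] and [Y = A B A]. The squared Frobenius norms
    [|M|^2 = tr(M M^T) = sum_ij M_ij^2] of these are
      [|X|^2 = 4 tr(A^4 B^2) + 4 tr(A^3 B A B) + tr(A^2 B A^2 B)] and
      [|Y|^2 = tr(A^2 B A^2 B)], hence [p = 3/2 (|X|^2 + |Y|^2)]
    ([trace_pencil6_frobenius]), a sum of squares of entries.

    The matrices [X] and [Y] come from the diagonal case: if [A] is diagonal with
    entries [x_i] then [p = 3 sum_ij b_ij^2 h(x_i, x_j)] with
    [h(x, y) = x^4 + x^3 y + x^2 y^2 + x y^3 + y^4], and
    [4 h(x, y) = (2 x^2 + x y)^2 + (2 y^2 + x y)^2 + 2 (x y)^2].

    Grouping the entries at [(i, j)] and [(j, i)] gives the quadratic forms: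
    [y] lists the diagonal entries of [X] and [Y], and [z_(i,j)] is
    [(X_ij, X_ji, Y_ij)], the weight of [Y_ij] being doubled because [Y] is
    symmetric ([frobenius_qform]). Both Gram matrices are diagonal with
    nonnegative entries. *)

(** * The coefficient of t^2 in the trace of the sixth power *)

Definition pencil (K : comNzRingType) n (A B : 'M[K]_n) : 'M[{poly K}]_n :=
  map_mx polyC A + 'X *: map_mx polyC B.

Definition mxcoef (K : comNzRingType) n k (N : 'M[{poly K}]_n) : 'M[K]_n :=
  map_mx (coefp k) N.

Lemma mxcoef_mulC (K : comNzRingType) n k (A : 'M[K]_n) (N : 'M[{poly K}]_n) :
  mxcoef k (map_mx polyC A *m N) = A *m mxcoef k N.
Proof.
apply/matrixP=> i j; rewrite !mxE /= coef_sum.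
by apply: eq_bigr => l _; rewrite !mxE coefCM.
Qed.

Lemma mxcoefD (K : comNzRingType) n k (M N : 'M[{poly K}]_n) :
  mxcoef k (M + N) = mxcoef k M + mxcoef k N.
Proof. by apply/matrixP=> i j; rewrite !mxE /= coefD. Qed.

Lemma mxcoef0_pencilM (K : comNzRingType) n (A B : 'M[K]_n) (N : 'M[{poly K}]_n) :
  mxcoef 0 (pencil A B *m N) = A *m mxcoef 0 N.
Proof.
rewrite mulmxDl -scalemxAl mxcoefD mxcoef_mulC -[RHS]addr0; congr (_ + _).
by apply/matrixP=> i j; rewrite !mxE /= coefXM.
Qed.

(** Multiplication by [A + t B] acts on coefficients by a two-term recurrence;
    iterating it expands a power of the pencil into words in [A] and [B]. *)
Lemma mxcoefS_pencilM (K : comNzRingType) n k (A B : 'M[K]_n)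
    (N : 'M[{poly K}]_n) :
  mxcoef k.+1 (pencil A B *m N) = A *m mxcoef k.+1 N + B *m mxcoef k N.
Proof.
rewrite mulmxDl -scalemxAl mxcoefD mxcoef_mulC; congr (_ + _).
rewrite -mxcoef_mulC.
by apply/matrixP=> i j; rewrite !mxE /= coefXM.
Qed.

Lemma mxcoef1 (K : comNzRingType) n k :
  mxcoef k (1 : 'M[{poly K}]_n) = if k is 0 then 1%:M else 0.
Proof.
apply/matrixP=> i j; rewrite !mxE /= coefMn coef1.
by case: k => [|k]; rewrite !mxE ?mul0rn.
Qed.

Lemma coef_mxtrace (K : comNzRingType) n k (N : 'M[{poly K}]_n) :
  (\tr N)`_k = \tr (mxcoef k N).
Proof. by rewrite coef_sum; apply: eq_bigr => i _; rewrite mxE. Qed.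

Lemma mxtrace_rot6 (K : comNzRingType) n (C1 C2 C3 C4 C5 C6 : 'M[K]_n) :
  \tr (C1 *m C2 *m C3 *m C4 *m C5 *m C6)
  = \tr (C6 *m C1 *m C2 *m C3 *m C4 *m C5).
Proof. by rewrite mxtrace_mulC !mulmxA. Qed.

(** Expanding the power gives fifteen words; each is carried by cyclic
    rotation to one of three representatives. The factors 6, 6 and 3 are the
    sizes of the rotation classes: [A^2 B A^2 B] has period three. *)
Lemma trace_pencil6_coef2 (K : comNzRingType) n (A B : 'M[K]_n) :
  (\tr (pencil A B ^+ 6))`_2 =
    \tr (A *m A *m A *m A *m B *m B) *+ 6
    + \tr (A *m A *m A *m B *m A *m B) *+ 6
    + \tr (A *m A *m B *m A *m A *m B) *+ 3.
Proof.
rewrite coef_mxtrace -[pencil A B ^+ 6]mulr1 !exprS expr0 mulr1 -!mulmxE.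
rewrite !(mxcoefS_pencilM, mxcoef0_pencilM) !mxcoef1 /=.
rewrite !(mulmx0, addr0, add0r, mulmx1) !(mulmxDr, mulmxA, mxtraceD).
pose rot := @mxtrace_rot6 K n.
rewrite (rot B A A A A B) (rot B B A A A A) (rot A B B A A A).
rewrite (rot A A B B A A) (rot A A A B B A).
rewrite (rot B A A A B A) (rot A B A A A B) (rot B A B A A A).
rewrite (rot A B A B A A) (rot A A B A B A).
rewrite (rot B A A B A A) (rot A B A A B A).
ring.
Qed.

(** * Frobenius norms *)

Definition frobenius (K : comNzRingType) n (M : 'M[K]_n) : K :=
  \sum_i \sum_j M i j ^+ 2.

Lemma frobenius_trace (K : comNzRingType) n (M : 'M[K]_n) :
  frobenius M = \tr (M *m M^T).
Proof.
apply: eq_bigr => i _; rewrite mxE; apply: eq_bigr => j _.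
by rewrite !mxE expr2.
Qed.

(** Expanding the two norms, the words are rotated to the same three
    representatives. The factors 2 and 3 are the denominator and the
    numerator of the constant 3/2, cleared so that the identity holds over every
    commutative ring. *)
Lemma trace_pencil6_frobenius (K : comNzRingType) n (A B : 'M[K]_n)
    (symA : A^T = A) (symB : B^T = B) :
  (\tr (pencil A B ^+ 6))`_2 *+ 2 =
    (frobenius ((A *m A *m B) *+ 2 + A *m B *m A)
     + frobenius (A *m B *m A)) *+ 3.
Proof.
rewrite trace_pencil6_coef2 !frobenius_trace !(mulr2n, linearD) /=.
rewrite !trmx_mul symA symB !(mulmxDl, mulmxDr) !mxtraceD !mulmxA.
pose rot := @mxtrace_rot6 K n.
rewrite (rot A A B B A A) (rot A A A B B A).
rewrite (rot A B A B A A) (rot A A B A B A) (rot A B A A B A).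
ring.
Qed.

(** * Diagonal quadratic forms *)

Lemma qform_diag (R : realType) k m (d : 'rV[R]_m) (y : 'cV[{mpoly R[k]}]_m) :
  qform (diag_mx d) y = \sum_i d 0 i *: y i 0 ^+ 2.
Proof.
rewrite /qform map_diag_mx mul_mx_diag mxE; apply: eq_bigr => i _.
by rewrite !mxE -mul_mpolyC expr2 mulrCA mulrA.
Qed.

Lemma psdmx_diag (R : realType) m (d : 'rV[R]_m) :
  (forall i, 0 <= d 0 i) -> psdmx (diag_mx d).
Proof.
move=> d_ge0; split=> [|x]; first exact: tr_diag_mx.
rewrite mul_mx_diag mxE sumr_ge0 // => i _.
by rewrite !mxE mulrAC mulr_ge0 // -expr2 sqr_ge0.
Qed.

Lemma is_sos0 (R : realType) k : is_sos (0 : {mpoly R[k]}).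
Proof. by exists 0, (fun=> 0); rewrite big_ord0. Qed.

Lemma is_sosD (R : realType) k (p q : {mpoly R[k]}) :
  is_sos p -> is_sos q -> is_sos (p + q).
Proof.
move=> [m [f ->]] [l [g ->]].
exists (m + l)%N, (fun i => match split i with inl j => f j | inr j => g j end).
rewrite big_split_ord; congr (_ + _); apply: eq_bigr => i _.
  by rewrite (unsplitK (inl i)).
by rewrite (unsplitK (inr i)).
Qed.

Lemma is_sos_sum (R : realType) k (I : finType) (P : pred I)
    (F : I -> {mpoly R[k]}) :
  (forall i, is_sos (F i)) -> is_sos (\sum_(i | P i) F i).
Proof. by move=> sosF; apply: big_ind => //; [exact: is_sos0|exact: is_sosD]. Qed.

Lemma is_sos_scale_sqr (R : realType) k (c : R) (p : {mpoly R[k]}) :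
  0 <= c -> is_sos (c *: p ^+ 2).
Proof.
move=> c_ge0; exists 1%N, (fun=> Num.sqrt c *: p).
by rewrite big_ord1 exprZn sqr_sqrtr.
Qed.

Lemma is_sos_qform_diag (R : realType) k m (d : 'rV[R]_m)
    (y : 'cV[{mpoly R[k]}]_m) :
  (forall i, 0 <= d 0 i) -> is_sos (qform (diag_mx d) y).
Proof.
move=> d_ge0; rewrite qform_diag.
by apply: is_sos_sum => i; apply: is_sos_scale_sqr.
Qed.

(** * Grouping the entries at (i, j) and (j, i) *)

Lemma sum_diag_pairs (V : zmodType) n (F : 'I_n -> 'I_n -> V) :
  \sum_i \sum_j F i j =
    \sum_i F i i + \sum_(i < n) \sum_(j < n | (i < j)%N) (F i j + F j i).
Proof.
have split_row i : \sum_j F i j =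
    F i i + (\sum_(j < n | (i < j)%N) F i j + \sum_(j < n | (j < i)%N) F i j).
  rewrite (bigD1 i) //= (bigID (fun j : 'I_n => (i < j)%N)) /=.
  congr (_ + (_ + _)); apply: eq_bigl => j; rewrite -val_eqE /=; lia.
rewrite (eq_bigr _ (fun i _ => split_row i)) !big_split /=; congr (_ + _).
rewrite [X in _ + X](exchange_big_dep xpredT) //= -big_split /=.
by apply: eq_bigr => i _; rewrite big_split.
Qed.

Definition diag_gram (R : realType) n (c : R) : 'M[R]_(n + n) :=
  diag_mx (const_mx c).

Definition pair_gram (R : realType) (c : R) : 'M[R]_3 :=
  diag_mx (\row_k [:: c; c; c *+ 2]`_k).

Definition diag_entries (K : comNzRingType) n (X Y : 'M[K]_n) : 'cV[K]_(n + n) :=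
  col_mx (\col_i X i i) (\col_i Y i i).

Definition pair_entries (K : comNzRingType) n (X Y : 'M[K]_n) i j : 'cV[K]_3 :=
  \col_k [:: X i j; X j i; Y i j]`_k.

(** The entries of [Y] at [(i, j)] and [(j, i)] coincide, so one coordinate of
    double weight accounts for both. *)
Lemma frobenius_qform (R : realType) k n (c : R) (X Y : 'M[{mpoly R[k]}]_n)
    (symY : Y^T = Y) :
  c *: (frobenius X + frobenius Y) =
    qform (diag_gram n c) (diag_entries X Y)
    + \sum_(i < n) \sum_(j < n | (i < j)%N)
        qform (pair_gram c) (pair_entries X Y i j).
Proof.
rewrite /frobenius -big_split /=; under eq_bigr => i _ do rewrite -big_split /=.
rewrite sum_diag_pairs scalerDr; congr (_ + _).
  rewrite qform_diag big_split_ord /= -big_split scaler_sumr.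
  apply: eq_bigr => i _ /=.
  by rewrite col_mxEu col_mxEd !mxE scalerDr.
rewrite scaler_sumr; apply: eq_bigr => i _.
rewrite scaler_sumr; apply: eq_bigr => j _.
have -> : Y j i = Y i j by rewrite -[in RHS]symY mxE.
rewrite qform_diag !big_ord_recl big_ord0 !mxE /= addr0.
by rewrite addrACA !scalerDr mulr2n scalerDl -!addrA.
Qed.

Theorem theorem1p4 (R : realType) (n : nat) (n_ge1 : (1 <= n)%N) :
  is_sos (trace_coef R n) /\
  exists (k l : nat) (U : 'M[R]_k) (S : 'M[R]_l)
    (y : 'cV[{mpoly R[nvars n]}]_k)
    (z : 'I_n -> 'I_n -> 'cV[{mpoly R[nvars n]}]_l),
    [/\ psdmx U, psdmx S &
      trace_coef R n =
        qform U y + \sum_(i < n) \sum_(j < n | (i < j)%N) qform S (z i j)].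
Proof.
have symA : (Amx R n)^T = Amx R n by apply/matrixP=> i j; rewrite !mxE mk_upairC.
have symB : (Bmx R n)^T = Bmx R n by apply/matrixP=> i j; rewrite !mxE mk_upairC.
pose Y := Amx R n *m Bmx R n *m Amx R n.
pose X := (Amx R n *m Amx R n *m Bmx R n) *+ 2 + Y.
have symY : Y^T = Y by rewrite !trmx_mul symA symB mulmxA.
pose c : R := 3 / 2.
have c_ge0 : 0 <= c by rewrite divr_ge0 ?ler0n.
have decomp : trace_coef R n = c *: (frobenius X + frobenius Y).
  have := trace_pencil6_frobenius symA symB.
  rewrite -/(trace_coef R n) -/Y -/X -[LHS]scaler_nat -[RHS]scaler_nat => e2.
  have two_neq0 : 2 != 0 :> R by rewrite pnatr_eq0.
  apply: (scalerI two_neq0); rewrite e2 scalerA; congr (_ *: _).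
  by rewrite /c mulrC divfK.
have U_ge0 i : 0 <= (const_mx c : 'rV_(n + n)) 0 i by rewrite mxE.
have S_ge0 i : 0 <= (\row_k [:: c; c; c *+ 2]`_k : 'rV_3) 0 i.
  by rewrite mxE; case: i => [[|[|[|//]]] ?] /=; rewrite ?mulrn_wge0.
rewrite decomp (frobenius_qform c X symY); split.
  apply: is_sosD; first exact: is_sos_qform_diag.
  by do 2!apply: is_sos_sum => ?; apply: is_sos_qform_diag.
exists (n + n)%N, 3%N, (diag_gram n c), (pair_gram c).
exists (diag_entries X Y), (pair_entries X Y).
by split=> //; apply: psdmx_diag.
Qed.
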